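(* Let $X$ be a locally compact paracompact non-$\sigma$-compact space. Then $$2^{L(X)}\leq\big|\mathcal T_D(X)\big|.$$
   Context: Compact, locally compact and paracompact spaces are assumed Hausdorff. $L(X)$ is the Lindelöf number of $X$ (the least infinite cardinal $\kappa$ such that every open cover of $X$ has a subcover of cardinality at most $\kappa$). For a Tychonoff space $X$, a one-point extension of $X$ is a Tychonoff space $Y$ containing $X$ as a dense subspace such that $Y\setminus X$ is a singleton; we write $Y=X\cup\{p\}$. Two extensions are identified if there is a homeomorphism between them fixing $X$ pointwise. $\mathcal T(X)$ is the set of all (equivalence classes of) one-point extensions of $X$, and $\mathcal T_D(X)=\{Y=X\cup\{p\}\in\mathcal T(X): p\notin\mathrm{cl}_Y A\text{ for any closed Lindelöf } A\subseteq X\}$ (closed meaning closed in $X$). *)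

(* Defs.v *)
From HB Require Import structures.
From mathcomp Require Import all_boot all_order all_algebra.
From mathcomp Require Import all_classical all_reals all_analysis.

Set Implicit Arguments.
Unset Strict Implicit.
Unset Printing Implicit Defensive.

Local Open Scope classical_set_scope.
Local Open Scope card_scope.

Section covering_properties.
Variable T : topologicalType.
Implicit Types (A : set T) (C D : set (set T)).

Definition open_cover A C := C `<=` open /\ A `<=` \bigcup_(U in C) U.

(* Covers by open sets of the ambient space T: for subspaces this gives the
   same notion as covers by relatively open sets. *)
Definition every_cover_reduces_to (K : Type) A :=
  forall C, open_cover A C -> exists D,
    [/\ D `<=` C, A `<=` \bigcup_(U in D) U & D #<= [set: K]].

Definition lindelof A := every_cover_reduces_to nat A.

Definition locally_finite C :=
  forall x : T, exists2 U, nbhs x U & finite_set [set A | C A /\ A `&` U !=set0].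

Definition refines D C := forall V, D V -> exists2 U, C U & V `<=` U.

Definition paracompact := hausdorff_space T /\
  forall C, open_cover setT C ->
    exists D, [/\ open_cover setT D, refines D C & locally_finite D].

Definition sigma_compact :=
  exists F : nat -> set T, (forall n, compact (F n)) /\ \bigcup_n F n = setT.

(* See [uniform_separatorP] for the link between [completely_regular_space]
   and separation by continuous functions into the unit interval. *)
Definition tychonoff_space := accessible_space T /\ completely_regular_space T.

End covering_properties.

(* K is a type of cardinality L(X); it is unique up to bijection, and
   [lindelof_number_exists] below provides one. *)
Definition is_lindelof_number (X : topologicalType) (K : Type) :=
  [/\ infinite_set [set: K], every_cover_reduces_to K [set: X] &
      forall K' : Type, infinite_set [set: K'] ->
        every_cover_reduces_to K' [set: X] -> [set: K] #<= [set: K']].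

Definition topological_embedding (X Y : topologicalType) (f : X -> Y) :=
  injective f /\
  forall U : set X, open U <-> exists2 V : set Y, open V & f @^-1` V = U.

Definition homeomorphism (X Y : topologicalType) (f : X -> Y) :=
  continuous f /\
  exists g : Y -> X, [/\ continuous g, cancel f g & cancel g f].

Section one_point_extensions.
Variable X : topologicalType.

Record one_point_extension := OnePointExtension {
  ext_space : topologicalType;
  ext_emb : X -> ext_space;
  ext_pt : ext_space;
  ext_tychonoff : tychonoff_space ext_space;
  ext_embedding : topological_embedding ext_emb;
  ext_dense : dense (range ext_emb);
  ext_remainder : ~` range ext_emb = [set ext_pt] }.

Implicit Types Y Z : one_point_extension.

Definition ext_equiv Y Z :=
  exists2 f : ext_space Y -> ext_space Z,
    homeomorphism f & forall x, f (ext_emb Y x) = ext_emb Z x.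

(* The universe of [set] and [#<=] is too small for [one_point_extension], so
   equivalence classes and sets of them are plain predicates. *)
Definition ext_class Y : one_point_extension -> Prop := fun Z => ext_equiv Y Z.

Definition T_D (c : one_point_extension -> Prop) : Prop :=
  exists2 Y, c = ext_class Y &
    forall A : set X, closed A -> lindelof A ->
      ~ closure (ext_emb Y @` A) (ext_pt Y).

End one_point_extensions.

Lemma injective_card_le (A B : Type) (f : A -> B) :
  injective f -> [set: A] #<= [set: B].
Proof.
move=> fI; suff /injfunPex[g] : exists2 f : A -> B,
    set_fun [set: A] [set: B] f & set_inj [set: A] f by exact: inj_card_le g.
by exists f => // x y _ _; exact: fI.
Qed.

Lemma least_cardinal (I : Type) (F : I -> Type) (i0 : I) :
  exists i, forall j, exists f : F i -> F j, injective f.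
Proof.
pose P := [set S : set (forall i, F i) |
  forall s t, S s -> S t -> forall i, s i = t i -> s = t].
have [|S [PS Smax]] := @Zorn_bigcup _ P.
  move=> G GP Gtot s t [A GA As] [B GB Bt].
  by have [AB|BA] := Gtot _ _ GA GB;
    [apply: (GP B) => //; exact: AB|apply: (GP A) => //; exact: BA].
have [i si] : exists i, forall y : F i, exists2 s, S s & s i = y.
  apply: contrapT => /forallNP noi.
  have ex i : {y : F i | forall s, S s -> s i <> y}.
    apply: cid; have /existsNP[y Hy] := noi i; exists y => s Ss sy.
    by apply: Hy; exists s.
  pose t i := sval (ex i).
  have tS s i : S s -> s i <> t i by exact: (svalP (ex i)).
  apply: (Smax (S `|` [set t])).
    split; first by move=> x Sx; left.
    by move=> /(_ t (or_intror erefl)) St; exact: (tS t i0 St).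
  move=> s u [Ss|->] [Su|->] // i; first exact: PS.
    by move=> /(tS _ _ Ss).
  by move=> /esym /(tS _ _ Su).
exists i => j; pose f y := projT1 (cid2 (si y)).
have fS y : S (f y) by rewrite /f; case: cid2.
have fK y : f y i = y by rewrite /f; case: cid2.
exists (fun y => f y j) => y z /PS fyz.
by rewrite -(fK y) -(fK z) fyz.
Qed.

Lemma lindelof_number_exists (X : topologicalType) :
  exists K : Type, is_lindelof_number X K.
Proof.
pose T := (X + nat)%type.
have Tinf : infinite_set [set: T].
  apply/infiniteP; apply: (@injective_card_le _ _ inr); by move=> ? ? [].
have Tcov : every_cover_reduces_to T [set: X].
  move=> C [Co XC]; pose g x := projT1 (cid2 (XC x I)).
  have gC x : C (g x) by rewrite /g; case: cid2.
  have gx x : g x x by rewrite /g; case: cid2.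
  exists (range g); split.
  - by move=> _ [x _ <-].
  - by move=> x _; exists (g x).
  - apply: (card_le_trans (card_image_le _ _)).
    by apply: (@injective_card_le _ _ inl); move=> ? ? [].
pose good (A : set T) := infinite_set [set: A] /\ every_cover_reduces_to A [set: X].
have mono (K K' : Type) : [set: K] #<= [set: K'] ->
    every_cover_reduces_to K [set: X] -> every_cover_reduces_to K' [set: X].
  move=> KK' H C /H[D [DC XD DK]]; exists D; split => //.
  exact: card_le_trans KK'.
have goodT : good setT.
  by split; [rewrite (eq_finite_set (card_setT _))
            |apply: mono Tcov; rewrite (card_le_eqr (card_setT _))].
have [[A [Ainf Acov]] Amin] :=
  least_cardinal (fun A : {A | good A} => sval A : Type) (exist good _ goodT).
exists A; split => // K' K'inf K'cov.
have [[] min] := least_cardinal (fun b : bool => if b then T else K') true.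
  have [f fI] := min false; apply: card_le_trans (injective_card_le fI).
  by rewrite (card_le_eql (card_setT _)); exact: card_leT.
have [f fI] := min true.
have fB : [set: range f] #= [set: K'].
  apply: (card_eq_trans (card_setT _)).
  have [g ->] : {g : {inj [set: K'] >-> T} | f = g}.
    by apply: Pinj => x y _ _; exact: fI.
  exact: card_image.
have goodB : good (range f).
  split; first by rewrite (eq_finite_set fB).
  by apply: mono K'cov; rewrite (card_le_eqr fB).
have [h hI] := Amin (exist good _ goodB).
by have := injective_card_le hI; rewrite (card_le_eqr fB).
Qed.

(* Main.v *)
Require Import Defs.
From HB Require Import structures.
From mathcomp Require Import all_boot all_order all_algebra.
From mathcomp Require Import all_classical all_reals all_analysis.
From mathcomp Require Import Rstruct.

(** A locally compact paracompact space is the disjoint union of clopen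
sigma-compact pieces: refine the cover by open sets lying in compact sets to a
locally finite one [D], and link two points when a finite chain of members of
[D], each meeting the next, joins them. A compact set meets finitely many members of
[D], so a chain class is exhausted by countably many compact sets; and any union
of classes is open ([sigma_compact_clopen_partition]). Write [q : X -> I] for the
map sending a point to its piece. Failure of sigma-compactness makes [I]
uncountable, and every open cover reduces to one of cardinality [I], as each
piece needs countably many members; hence the Lindelof number is at most the
cardinality of [I].

A set [T] of pieces that is uncountable yields a one-point extension of [X]: the
neighbourhoods of the new point are the sets containing it and all the pieces in
[T] but countably many. These neighbourhoods have a clopen base, which together with complete regularity
of [X] makes the extension Tychonoff. A closed Lindelof set meets countably many
pieces, so the new point is not in its closure. Equivalent extensions have the
same open neighbourhood traces on [X], so the extensions given by [T] and [T']
can only be equivalent if [T `\` T'] is countable ([tail_extension_equiv]).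

It remains to find, for each subset [S] of the Lindelof number [K], an
uncountable [T S] such that [T S `\` T S'] is uncountable whenever [S] and [S']
differ. This rests on [card_square_le], the inequality [I * I <= I] for infinite
[I], which embeds [K * bool * I] into [I]: take for [T S] the image of the
triples [(k, b, i)] where [b] says whether [k] belongs to [S]. *)

Set Implicit Arguments.
Unset Strict Implicit.
Unset Printing Implicit Defensive.

Import Order.TTheory GRing.Theory Num.Theory.
Import numFieldNormedType.Exports.

Local Open Scope classical_set_scope.
Local Open Scope card_scope.

(** * Cardinal arithmetic *)

Lemma card_le_total (T U : Type) (A : set T) (B : set U) : A #<= B \/ B #<= A.
Proof.
have [b min] :=
  least_cardinal (fun b : bool => if b then A : Type else B : Type) true.
have [f /injective_card_le] := min (~~ b).
by case: b {min} f => /= _;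
  rewrite (card_le_eql (card_setT _)) (card_le_eqr (card_setT _)); [left|right].
Qed.

Lemma card_le_fun (T U : Type) (u0 : U) (A : set T) (B : set U) : A #<= B ->
  exists f : T -> U, (forall x, A x -> B (f x)) /\
    forall x y, A x -> A y -> f x = f y -> x = y.
Proof.
move=> /card_leP/unsquash g.
pose f x := if pselect (A x) is left Ax then val (g (SigSub (mem_set Ax))) else u0.
exists f; split=> [x|x y]; rewrite /f; case: pselect => // Ax _.
  exact: set_valP.
case: pselect => // Ay _ /val_inj /(@inj _ _ _ g).
by rewrite !inE => /(_ I I) /(congr1 val).
Qed.

Section square.
Variable I : Type.
Implicit Types (G : set ((I * I) * I)).

(** The partial pairings are encoded by their graphs, so that the union of a chain
needs no gluing of functions. *)
Let field G := [set x | exists y, G ((x, x), y)].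

(** [G] is the graph of an injection from [A * A] to [A], with [A := field G]. *)
Let pairing_graph G := [/\
  forall p y z, G (p, y) -> G (p, z) -> y = z,
  forall p q y, G (p, y) -> G (q, y) -> p = q,
  forall x y z, G ((x, y), z) -> [/\ field G x, field G y & field G z] &
  forall x y, field G x -> field G y -> exists z, G ((x, y), z)].

(** Each clause speaks of at most two elements of [G], and so can be checked in
a pairing graph that contains both. *)
Lemma pairing_graph_directed G : (forall z t, G z -> G t ->
    exists H, [/\ pairing_graph H, H z, H t & H `<=` G]) ->
  pairing_graph G.
Proof.
move=> dirG; split.
- move=> p y z Gy Gz; have [H [[fH _ _ _] Hy Hz _]] := dirG _ _ Gy Gz.
  exact: fH Hy Hz.
- move=> p q y Gp Gq; have [H [[_ iH _ _] Hp Hq _]] := dirG _ _ Gp Gq.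
  exact: iH Hp Hq.
- move=> x y z Gz; have [H [[_ _ cH _] Hz _ HG]] := dirG _ _ Gz Gz.
  by have [[a /HG ?] [b /HG ?] [c /HG ?]] := cH _ _ _ Hz; split; [exists a|exists b|exists c].
- move=> x y [a Ga] [b Gb]; have [H [[_ _ _ tH] Ha Hb HG]] := dirG _ _ Ga Gb.
  have [||z /HG Gz] := tH x y; [by exists a|by exists b|by exists z].
Qed.

(** Take, by Zorn's lemma, a maximal injection [A * A -> A] extending one on a
countable set. If the complement of [A] embeds into [A], then so does [I], which
is then as good as [A]. Otherwise a copy [g A] of [A] lies outside [A]; as [A]
absorbs three copies of [A * A], the three missing parts of the square of
[A `|` g A] embed into [g A], against maximality. *)
Lemma card_square_le : infinite_set [set: I] ->
  exists f : I -> I -> I, forall x y z t, f x y = f z t -> x = z /\ y = t.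
Proof.
move=> infI; have [i0 _] := infinite_setN0 infI.
have /infiniteP/(card_le_fun i0)[iota [_ iotaI']] := infI.
have iotaI : injective iota by move=> m n; exact: iotaI'.
(* The countable pairing [G0] is kept inside every candidate: it provides the
   distinct elements [iota n] of [A] used as tags below. *)
pose G0 := [set z | exists m n, z = ((iota m, iota n), iota (pickle (m, n)))].
have fG0 n : field G0 (iota n) by exists (iota (pickle (n, n))); exists n, n.
have pG0 : pairing_graph G0.
  split.
  - by move=> p y z [m [n [-> ->]]] [m' [n' [/iotaI -> /iotaI -> ->]]].
  - move=> p q y [m [n [-> ->]]] [m' [n' [->]]].
    by move=> /iotaI /(pcan_inj pickleK) [-> ->].
  - by move=> x y z [m [n [-> -> ->]]]; split.
  - move=> x y [a [m [_ [-> _ _]]]] [b [n [_ [-> _ _]]]].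
    by exists (iota (pickle (m, n))), m, n.
have [F FP Ftot|G [PG Gmax]] := @Zorn_bigcup _ [set G | pairing_graph (G0 `|` G)].
  apply: pairing_graph_directed => z t.
  have sub H : F H -> G0 `|` H `<=` G0 `|` \bigcup_(X in F) X.
    by move=> FH; apply: setUS => w Hw; exists H.
  move=> [z0|[H FH Hz]] [t0|[H' FH' Ht]].
  - by exists G0; split => //; left.
  - by exists (G0 `|` H'); split; [exact: FP|left|right|exact: sub].
  - by exists (G0 `|` H); split; [exact: FP|right|left|exact: sub].
  - by have [HH|HH] := Ftot _ _ FH FH'; [exists (G0 `|` H')|exists (G0 `|` H)];
      (split; [exact: FP|right|right|exact: sub]) => //; exact: HH.
have {PG} := PG : pairing_graph (G0 `|` G).
set H := G0 `|` G => -[Hf Hi Hc Ht].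
pose A := field H.
have Aiota n : A (iota n) by have [y ?] := fG0 n; exists y; left.
have /choice[f0 f0P] : forall p : I * I, exists z, A p.1 /\ A p.2 -> H (p, z).
  move=> [x y]; have [[Ax Ay]|nA] := pselect (A x /\ A y); last by exists x => /nA.
  by have [z Hz] := Ht _ _ Ax Ay; exists z.
pose f x y := f0 (x, y).
have fH x y : A x -> A y -> H ((x, y), f x y) by move=> Ax Ay; exact: f0P.
have fA x y : A x -> A y -> A (f x y) by move=> Ax Ay; have [] := Hc _ _ _ (fH _ _ Ax Ay).
have fI x y z t : A x -> A y -> A z -> A t -> f x y = f z t -> x = z /\ y = t.
  move=> Ax Ay Az At e.
  have := fH _ _ Az At; rewrite -e => /(Hi _ _ _ (fH _ _ Ax Ay)) [-> ->] //.
have [/(card_le_fun i0)[g [gA gI]]|/(card_le_fun i0)[g [gA gI]]] :=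
  card_le_total (~` A) A.
  (* [h] embeds [I] into [A]; the tags 0 and 1 separate [A] from its complement. *)
  pose h x := if pselect (A x) then f (iota 0) x else f (iota 1) (g x).
  have hA x : A (h x).
    by rewrite /h; case: pselect => Ax; apply: fA => //; exact: gA.
  have hI : injective h.
    move=> x y; rewrite /h; case: pselect => Ax; case: pselect => Ay.
    - by move=> /fI [].
    - by move=> /fI [] //; [exact: gA|move=> /iotaI].
    - by move=> /fI [] //; [exact: gA|move=> /iotaI].
    - by move=> /fI [] //; [exact: gA|exact: gA|move=> _ /gI ->].
  exists (fun x y => f (h x) (h y)) => x y z t /fI[] // /hI -> /hI ->//.
have {Hc}HA x y z : H ((x, y), z) -> [/\ A x, A y & A z] by move=> /Hc.
(* [j] identifies [bool * A] with [A `|` g A]; the pair [(false, false)] of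
   booleans is the square of [A], and [N] extends the pairing to the rest. *)
pose j (b : bool) x := if b then g x else x.
have jI b c x y : A x -> A y -> j b x = j c y -> b = c /\ x = y.
  case: b c => -[] /= Ax Ay e.
  - by split => //; exact: gI e.
  - by case: (gA _ Ax); rewrite e.
  - by case: (gA _ Ay); rewrite -e.
  - by [].
pose c (b b' : bool) := iota (b + b'.*2).
have cI b b' d d' : c b b' = c d d' -> b = d /\ b' = d'.
  by move=> /iotaI; case: b b' d d' => -[] [] [].
pose N := [set z | exists b b' x y, [/\ b || b', A x, A y &
  z = ((j b x, j b' y), g (f (c b b') (f x y)))]].
case: (Gmax (G `|` N)).
  split; first by move=> z Gz; left.
  pose b := iota 0; have Ab : A b by exact: Aiota.
  move=> /(_ ((g b, g b), g (f (c true true) (f b b)))) GN.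
  suff : A (g b) by exact: gA.
  by exists (g (f (c true true) (f b b))); right; apply: GN; right; exists true, true, b, b.
rewrite /= setUA -/H.
have HNf x : field (H `|` N) x <-> exists b a, A a /\ x = j b a.
  split.
    move=> [y [Hx|[b [b' [x' [y' [_ Ax' Ay' [-> _ _]]]]]]]].
      by exists false, x; split => //; exists y.
    by exists b, x'.
  move=> [[] [a [Aa ->]]] /=.
    by exists (g (f (c true true) (f a a))); right; exists true, true, a, a.
  by have [y Hy] := Aa; exists y; left.
have fN b b' x y : A x -> A y -> A (f (c b b') (f x y)).
  by move=> Ax Ay; apply: (fA); [exact: Aiota|exact: fA].
have NnA b b' x y : b || b' -> A x -> A y -> A (j b x) -> A (j b' y) -> False.
  by case: b b' => -[] //= _ Ax Ay; [move=> /(gA _ Ax)|move=> /(gA _ Ax)|move=> _ /(gA _ Ay)].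
split.
- move=> [p p'] y z [Hy|[b [b' [x [x' [bb Ax Ax' [-> -> ->]]]]]]].
    move=> [Hz|[b [b' [x [x' [bb Ax Ax' [e e' _]]]]]]].
      exact: Hf Hy Hz.
    by move: Hy; rewrite e e' => /HA[jA jA' _]; case: (NnA _ _ _ _ bb Ax Ax' jA jA').
  move=> [/HA[jA jA' _]|]; first by case: (NnA _ _ _ _ bb Ax Ax' jA jA').
  move=> [d [d' [w [w' [dd Aw Aw' [+ + ->]]]]]].
  by move=> /jI[] // -> -> /jI[] // -> ->.
- move=> p q y [|].
    case: p => [p p'] Hp [|]; first exact: Hi.
    move=> [b [b' [x [x' [bb Ax Ax' [_ e]]]]]].
    by case: (HA _ _ _ Hp) => _ _; rewrite e => /(gA _ (fN b b' _ _ Ax Ax')).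
  move=> [b [b' [x [x' [bb Ax Ax' [-> ->]]]]]] [|].
    by case: q => q q' /HA[_ _] /(gA _ (fN b b' _ _ Ax Ax')).
  move=> [d [d' [w [w' [dd Aw Aw' [->]]]]]].
  move=> /(gI _ _ (fN _ _ _ _ Ax Ax') (fN _ _ _ _ Aw Aw')).
  move=> /(fI _ _ _ _ (Aiota _) (fA _ _ Ax Ax') (Aiota _) (fA _ _ Aw Aw')).
  by move=> [/cI[-> ->] /(fI _ _ _ _ Ax Ax' Aw Aw')[-> ->]].
- move=> x y z [/HA[Ax Ay Az]|[b [b' [w [w' [bb Aw Aw' [-> -> ->]]]]]]].
    by split; apply/HNf; [exists false, x|exists false, y|exists false, z].
  split; apply/HNf; [by exists b, w|by exists b', w'|].
  by exists true, (f (c b b') (f w w')); split => //; exact: fN.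
- move=> x y /HNf[b [w [Aw ->]]] /HNf[b' [w' [Aw' ->]]].
  have [bb|] := boolP (b || b').
    by exists (g (f (c b b') (f w w'))); right; exists b, b', w, w'.
  by case: b b' => -[] //= _; exists (f w w'); left; exact: fH.
Qed.

End square.

Lemma fun_card_le (T U : Type) (A : set T) (f : T -> U) :
  (forall x y, A x -> A y -> f x = f y -> x = y) -> A #<= [set: U].
Proof.
move=> fI; suff /injfunPex[g] : exists2 g : T -> U,
    set_fun A [set: U] g & set_inj A g by exact: inj_card_le g.
by exists f => // x y; rewrite !inE; exact: fI.
Qed.

Lemma card_le_bigcup_countable (I T : Type) (D : I -> set T) :
  infinite_set [set: I] -> (forall i, countable (D i)) ->
  \bigcup_i D i #<= [set: I].
Proof.
move=> infI cD; have [i0 _] := infinite_setN0 infI.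
have [f fI] := card_square_le infI.
have /infiniteP/(card_le_fun i0)[iota [_ iotaI]] := infI.
have /choice[e eI] : forall i, exists e : T -> nat,
    forall x y, D i x -> D i y -> e x = e y -> x = y.
  by move=> i; have [e [_ eI]] := card_le_fun 0%N (cD i); exists e.
have /choice[s sD] : forall x, exists i, (\bigcup_i D i) x -> D i x.
  move=> x; have [[i _ Dx]|nD] := pselect ((\bigcup_i D i) x); first by exists i.
  by exists i0.
apply: (@fun_card_le _ _ _ (fun x => f (s x) (iota (e (s x) x)))) => x y Dx Dy.
move=> /fI[sxy /iotaI exy]; apply: (eI (s x)); first exact: sD.
  by rewrite sxy; exact: sD.
by rewrite exy // sxy.
Qed.

(** The boolean in the index makes the construction symmetric: a point [k] on which
[S] and [S'] disagree puts into [T S] a full copy of [I] that avoids [T S'],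
whichever of the two sets contains [k]. *)
Lemma uncountable_difference_family (I K : Type) :
  ~ countable [set: I] -> [set: K] #<= [set: I] -> infinite_set [set: K] ->
  exists T : set K -> set I, (forall S, ~ countable (T S)) /\
    forall S S', S <> S' -> ~ countable (T S `\` T S').
Proof.
move=> uI KI infK.
have infI : infinite_set [set: I] by move=> /finite_set_countable.
have [i0 _] := infinite_setN0 infI; have [k0 _] := infinite_setN0 infK.
have [f fI] := card_square_le infI.
have /infiniteP/(card_le_fun i0)[iota [_ iotaI]] := infI.
have [kappa [_ kappaI]] := card_le_fun i0 KI.
pose h k (b : bool) i := f (f (kappa k) (iota b)) i.
have hI k b i k' b' i' : h k b i = h k' b' i' -> [/\ k = k', b = b' & i = i'].
  move=> /fI[/fI[/kappaI-> // /iotaI bb] ->]; split=> //.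
  by case: b b' bb => -[] // /(_ Logic.I Logic.I).
have hU k b (A : set I) : range (h k b) `<=` A -> ~ countable A.
  move=> hA cA; apply: uI; apply: (@sub_countable _ _ _ A) cA.
  apply: (card_le_trans _ (subset_card_le hA)).
  rewrite (card_le_eqr (inj_card_eq _))//.
  by move=> i j _ _ /hI[].
pose T (S : set K) := [set j | exists k i, j = h k `[< S k >] i].
exists T; split => [S|S S' SS'].
  by apply: (hU k0 `[< S k0 >]) => _ [i _ <-]; exists k0, i.
have [k Sk] : exists k, `[< S k >] <> `[< S' k >].
  apply: contrapT => /forallNP H; apply: SS'; apply/funext => k.
  by apply/propext; apply: asbool_eq_equiv; exact: contrapT (H k).
apply: (hU k `[< S k >]) => _ [i _ <-]; split; first by exists k, i.
by move=> [k' [i' /hI[<- Sk' _]]]; exact: Sk.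
Qed.

(** * Partition of a locally compact paracompact space *)

Section compactness.
Variable X : topologicalType.
Implicit Types (A K : set X) (C D : set (set X)).

(** If [Q K] failed, the sets [U] with [Q (K `\` U)] would form a proper filter
containing [K], without cluster point in [K]. *)
Lemma compact_local_ind (Q : set X -> Prop) K :
  Q set0 -> (forall A B, A `<=` B -> Q B -> Q A) ->
  (forall A B, Q A -> Q B -> Q (A `|` B)) ->
  compact K -> (forall x, K x -> exists2 U, nbhs x U & Q U) -> Q K.
Proof.
move=> Q0 QS QU cK Qloc; apply: contrapT => nQK.
pose F : set_system X := [set U | Q (K `\` U)].
have FF : ProperFilter F.
  split; first by rewrite /F /= setD0.
  split; first by rewrite /F /= setDT.
  - by move=> A B FA FB; rewrite /F /= setDIr; exact: QU.
  - by move=> A B AB; apply: QS => x [Kx nBx]; split => // /AB.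
have [|x [Kx xF]] := cK F FF; first by rewrite /F /= setDv.
have [U xU QU'] := Qloc x Kx.
have [|y [nUy Uy]] := xF (~` U) U _ xU; last exact: nUy.
by apply: QS QU' => y [_] /contrapT.
Qed.

Lemma compact_finite_subcover C K : compact K -> open_cover K C ->
  exists D, [/\ finite_set D, D `<=` C & K `<=` \bigcup_(U in D) U].
Proof.
move=> cK [Co KC].
apply: (@compact_local_ind (fun A => exists D,
  [/\ finite_set D, D `<=` C & A `<=` \bigcup_(U in D) U])) cK _.
- by exists set0; split.
- by move=> A B AB [D [fD DC BD]]; exists D; split => //; exact: subset_trans BD.
- move=> A B [D [fD DC AD]] [E [fE EC BE]]; exists (D `|` E); split.
  + by rewrite finite_setU.
  + by move=> U [/DC|/EC].
  + by rewrite bigcup_setU; exact: setUSS.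
- move=> x /KC[U CU Ux]; exists U; first by apply: open_nbhs_nbhs; split=> //; exact: Co.
  by exists [set U]; split => // [V ->//|]; rewrite bigcup_set1.
Qed.

Lemma compact_meets_finitely_many D K : locally_finite D -> compact K ->
  finite_set [set V | D V /\ K `&` V !=set0].
Proof.
move=> lfD cK.
apply: (@compact_local_ind (fun A => finite_set [set V | D V /\ A `&` V !=set0])) cK _.
- rewrite (_ : [set V | _] = set0) //; apply/seteqP; split => // V [_].
  by rewrite set0I => -[].
- move=> A B AB; apply: sub_finite_set => V [DV [x [Ax Vx]]]; split => //.
  by exists x; split => //; exact: AB.
- move=> A B fA fB; apply: (@sub_finite_set _ _
    ([set V | D V /\ A `&` V !=set0] `|` [set V | D V /\ B `&` V !=set0])); last first.
    by rewrite finite_setU.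
  by move=> V [DV [x [[Ax|Bx] Vx]]]; [left|right]; split => //; exists x.
- move=> x _; have [U xU fU] := lfD x; exists U => //.
  by apply: sub_finite_set fU => V [DV]; rewrite setIC.
Qed.

Lemma bigcup_sub_compact (G : set (set X)) : finite_set G ->
  (forall V, G V -> exists2 K, compact K & V `<=` K) ->
  exists2 K, compact K & \bigcup_(V in G) V `<=` K.
Proof.
move=> fG GK.
have /choice[k kP] : forall V, exists K, G V -> compact K /\ V `<=` K.
  move=> V; have [/GK[K cK VK]|nG] := pselect (G V); first by exists K.
  by exists set0 => /nG.
exists (\bigcup_(V in G) k V); last first.
  by move=> x [V GV Vx]; exists V => //; exact: (kP V GV).2.
rewrite -(bigsetU_fset_set _ fG) big_seq; apply: bigsetU_compact => V.
by rewrite in_fset_set // => /set_mem/kP[].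
Qed.

Lemma sigma_compact_countable_cover C : countable C ->
  (forall K, C K -> compact K) -> \bigcup_(K in C) K = setT -> sigma_compact X.
Proof.
move=> cC CK CT; have [e [_ eI]] := card_le_fun 0%N cC.
exists (fun n => \bigcup_(K in [set K | C K /\ e K = n]) K); split.
  move=> n; have [[K [CK' eK]]|nK] := pselect (exists K, C K /\ e K = n).
    rewrite (_ : [set _ | _] = [set K]); first by rewrite bigcup_set1; exact: CK.
    by apply/seteqP; split => [L [CL eL]|L ->] //; apply: eI => //; rewrite eL.
  rewrite (_ : [set _ | _] = set0); first by rewrite bigcup_set0; exact: compact0.
  by apply/seteqP; split => // K ?; apply: nK; exists K.
apply/seteqP; split => // x _; have : [set: X] x by [].
by rewrite -CT => -[K CK' Kx]; exists (e K) => //; exists K.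
Qed.

End compactness.

Section chain_components.
Variables (X : topologicalType) (D : set (set X)).
Hypotheses (Dcov : open_cover setT D) (Dlf : locally_finite D).
Hypothesis Dcpt : forall V, D V -> exists2 K, compact K & V `<=` K.
Implicit Types A : set X.

Definition saturated A := forall V, D V -> V `&` A !=set0 -> V `<=` A.

(** The points linked to [x] by a chain of members of [D]: defined as the least
saturated set containing [x], it avoids any induction on the length of chains
outside the proof of sigma-compactness. *)
Definition chain_component x := [set y | forall A, saturated A -> A x -> A y].

Lemma saturated_open A : saturated A -> open A.
Proof.
move=> satA; rewrite openE => x Ax; have [V DV Vx] := Dcov.2 x I.
have VA : V `<=` A by apply: satA => //; exists x.
rewrite /interior; apply: filterS VA _; apply: open_nbhs_nbhs.
by split => //; exact: Dcov.1.
Qed.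

Lemma saturatedC A : saturated A -> saturated (~` A).
Proof.
by move=> satA V DV [z [Vz nAz]] y Vy Ay; apply: nAz; apply: (satA V) => //; exists y.
Qed.

Lemma chain_component_refl x : chain_component x x. Proof. by move=> A _. Qed.

Lemma saturated_chain_component x : saturated (chain_component x).
Proof.
move=> V DV [z [Vz xz]] y Vy A satA Ax; apply: (satA V) => //.
by exists z; split => //; exact: xz.
Qed.

(** Symmetry of the relation: a saturated set containing [y] but not [x] would
have a saturated complement separating [x] from [y]. *)
Lemma chain_component_eq x y : chain_component x y ->
  chain_component x = chain_component y.
Proof.
move=> xy; have yx : chain_component y x.
  move=> A satA Ay; apply: contrapT => nAx.
  exact: (xy _ (saturatedC satA) nAx).
apply/seteqP; split => z h A satA; first by move=> /(yx A satA); exact: h.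
by move=> /(xy A satA); exact: h.
Qed.

Lemma chain_component_open (S : set (set X)) : open (chain_component @^-1` S).
Proof.
apply: saturated_open => V DV [z [Vz Sz]] y Vy /=.
rewrite -(@chain_component_eq z y)//.
apply: (@saturated_chain_component z V) => //.
by exists z; split => //; exact: chain_component_refl.
Qed.

(** The points at chain distance at most [n] from [x] lie in a compact set, by
induction on [n]: a compact set meets finitely many members of [D], each of them
inside a compact set. *)
Lemma chain_component_sigma_compact x : exists F : nat -> set X,
  (forall n, compact (F n)) /\ chain_component x `<=` \bigcup_n F n.
Proof.
(* [st n] is the [n]-fold iterated star of [x] with respect to [D]. *)
pose st := fix st n := if n is m.+1 then
  \bigcup_(V in [set V | D V /\ st m `&` V !=set0]) V else [set x].
have /choice[F FP] : forall n, exists K, compact K /\ st n `<=` K.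
  elim=> [|n [K [cK nK]]]; first by exists [set x]; split => //; exact: compact_set1.
  have [||L cL nL] := @bigcup_sub_compact X [set V | D V /\ st n `&` V !=set0].
  - apply: sub_finite_set (compact_meets_finitely_many Dlf cK) => V [DV [y [ny Vy]]].
    by split => //; exists y; split => //; exact: nK.
  - by move=> V [/Dcpt].
  - by exists L.
exists F; split => [n|y xy]; first exact: (FP n).1.
suff satst : saturated (\bigcup_n st n).
  have [|n _ ny] := xy _ satst; first by exists 0%N.
  by exists n => //; exact: (FP n).2.
move=> V DV [z [Vz [n _ nz]]] t Vt; exists n.+1 => //=; exists V => //.
by split => //; exists z.
Qed.

End chain_components.

(** The members of a locally finite refinement of the cover by open sets lying in
compact sets satisfy the hypotheses on [D] above; the pieces are the chain
components. *)
Lemma sigma_compact_clopen_partition (X : topologicalType) :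
  locally_compact [set: X] -> paracompact X ->
  exists (I : Type) (q : X -> I),
    [/\ forall i, exists x, q x = i,
        forall S, open (q @^-1` S) &
        forall i, exists F : nat -> set X,
          (forall n, compact (F n)) /\ q @^-1` [set i] `<=` \bigcup_n F n].
Proof.
move=> lcX [_ pX].
have [|D [Dcov Dref Dlf]] := pX [set U | open U /\ exists2 K, compact K & U `<=` K].
  split=> [U []//|x _]; have [U] := lcX x I; rewrite withinET => xU [cU _].
  exists U°; last exact: xU.
  by split; [exact: open_interior|exists U => //; exact: interior_subset].
have Dcpt V : D V -> exists2 K, compact K & V `<=` K.
  by move=> /Dref[U [_ [K cK UK]] VU]; exists K => //; exact: subset_trans UK.
pose E := chain_component D.
pose q x : set_type (range E) := SigSub (mem_set (imageT E x)).
have qE x : val (q x) = E x by [].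
exists (set_type (range E)), q; split.
- by move=> [i iE]; have /set_mem[x _ xi] := iE; exists x; apply: val_inj; rewrite qE.
- move=> S; rewrite (_ : q @^-1` S = E @^-1` (val @` S)).
    exact: chain_component_open.
  apply/seteqP; split => [x Sx|x [j Sj jx]] /=; first by exists (q x).
  by rewrite (_ : q x = j)//; exact: val_inj.
- move=> [i iE]; have /set_mem[x _ xi] := iE.
  have [F [cF xF]] := chain_component_sigma_compact Dlf Dcpt x.
  exists F; split => // y /(congr1 val)/=; rewrite -xi => yx; apply: xF.
  by rewrite -[chain_component D x]yx; exact: chain_component_refl.
Qed.

Section partition_cardinality.
Variables (X : topologicalType) (I : Type) (q : X -> I).
Hypothesis qcpt : forall i, exists F : nat -> set X,
  (forall n, compact (F n)) /\ q @^-1` [set i] `<=` \bigcup_n F n.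

Lemma sigma_compact_of_countable_partition : countable [set: I] -> sigma_compact X.
Proof.
move=> cI; have /choice[F FP] := qcpt.
apply: (@sigma_compact_countable_cover X (\bigcup_i range (F i))).
- by apply: bigcup_countable => // i _; exact: sub_countable (card_image_le _ _) _.
- by move=> _ [i _ [n _ <-]]; exact: (FP i).1.
- apply/seteqP; split => // x _; have [n _ nx] := (FP (q x)).2 x erefl.
  by exists (F (q x) n) => //; exists (q x) => //; exists n.
Qed.

(** Each piece is covered by countably many members, and [I * nat] has the
cardinality of [I]. *)
Lemma cover_reduces_to_partition : infinite_set [set: I] ->
  every_cover_reduces_to I [set: X].
Proof.
move=> infI C [Co XC]; have /choice[F FP] := qcpt.
have /choice[D DP] : forall p : I * nat, exists D, [/\ finite_set D, D `<=` C &
    F p.1 p.2 `<=` \bigcup_(U in D) U].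
  move=> [i n]; apply: compact_finite_subcover; first exact: (FP i).1.
  by split => // x _; exact: XC.
exists (\bigcup_i \bigcup_n D (i, n)); split.
- by move=> U [i _ [n _]]; have [_ + _] := DP (i, n); exact.
- move=> x _; have [n _ nx] := (FP (q x)).2 x erefl.
  have [_ _ /(_ x nx)[U DU Ux]] := DP (q x, n).
  by exists U => //; exists (q x) => //; exists n.
- apply: card_le_bigcup_countable => // i; apply: bigcup_countable => // n _.
  by have [/finite_set_countable] := DP (i, n).
Qed.

End partition_cardinality.

(** * Adding a point along a filter *)

(** The space [X] with a point [None] added, whose neighbourhoods trace the open
members of the filter [F] on [X]. *)
Definition point_ext (X : topologicalType) (F : filter_on X) : Type := option X.

Section point_extension_topology.
Variables (X : topologicalType) (F : filter_on X).
Local Notation Y := (point_ext F).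

HB.instance Definition _ := Choice.on Y.

Definition point_ext_open (U : set Y) : Prop :=
  open (Some @^-1` U) /\ (U None -> filter F (Some @^-1` U)).

Lemma point_ext_openT : point_ext_open setT.
Proof. by split; [exact: openT|move=> _; exact: filterT]. Qed.

Lemma point_ext_openI : setI_closed point_ext_open.
Proof.
move=> U V [oU FU] [oV FV]; split; first exact: openI.
by move=> [UN VN]; apply: filterI; [exact: FU|exact: FV].
Qed.

Lemma point_ext_open_bigU (J : Type) (f : J -> set Y) :
  (forall j, point_ext_open (f j)) -> point_ext_open (\bigcup_j f j).
Proof.
move=> fo; split; first by apply: bigcup_open => j _; exact: (fo j).1.
move=> [j _ fj]; apply: filterS ((fo j).2 fj) => x fx.
by exists j.
Qed.

HB.instance Definition _ := isOpenTopological.Build Y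
  point_ext_openT point_ext_openI point_ext_open_bigU.

Lemma point_ext_openE (U : set Y) : open U = point_ext_open U.
Proof. by []. Qed.

End point_extension_topology.

Section point_extension.
Variables (X : topologicalType) (F : filter_on X).
Local Notation Y := (point_ext F).
Local Notation some := (Some : X -> Y).

Lemma preimage_image_some (U : set X) : some @^-1` (some @` U) = U.
Proof. by apply/seteqP; split => [x [y Uy [<-]]//|x Ux]; exists x. Qed.

Lemma point_ext_open_some (U : set X) : open U -> open (some @` U).
Proof.
by move=> oU; rewrite point_ext_openE; split; [rewrite preimage_image_some|case].
Qed.

Lemma point_ext_embedding : topological_embedding some.
Proof.
split=> [x y []//|U]; split => [oU|[V [oV _] <-//]].
by exists (some @` U); [exact: point_ext_open_some|rewrite preimage_image_some].
Qed.

Lemma point_ext_dense : ~ filter F set0 -> dense (range some).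
Proof.
move=> F0 O [[x|] Ox] [oO FO]; first by exists (some x); split.
have FO' := FO Ox; apply: contrapT => nO; apply: F0.
apply: filterS FO' => x /= xO; apply: nO.
by exists (some x); split.
Qed.

Lemma point_ext_remainder : ~` range some = [set (None : Y)].
Proof.
by apply/seteqP; split => [[x []|//]|_ -> [x _]//]; exists x.
Qed.

Hypothesis Xlc : locally_compact [set: X].
Hypothesis Xhaus : hausdorff_space X.
Hypothesis Fclopen : forall U, filter F U ->
  exists W, [/\ clopen W, filter F W & W `<=` U].
Hypothesis Ffree : forall x, filter F (~` [set x]).

Lemma point_ext_accessible : accessible_space Y.
Proof.
have XT1 := hausdorff_accessible Xhaus.
move=> [x|] [y|] // xy.
- have [|A [oA xA yA]] := XT1 x y; first by apply: contraNN xy => /eqP ->.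
  exists (some @` A); split; first exact: point_ext_open_some.
    by rewrite inE; exists x => //; rewrite -inE.
  by rewrite inE => -[z Az [zy]]; move: yA; rewrite inE; apply; rewrite -zy.
- exists (range some); split; first by apply: point_ext_open_some; exact: openT.
    by rewrite inE; exists x.
  by rewrite inE => -[].
- exists (~` [set some y]); split.
  + have E : some @^-1` (~` [set some y]) = ~` [set y].
      by apply/seteqP; split => z zy; [move=> zy'|case => zy']; apply: zy; rewrite /= zy'.
    rewrite point_ext_openE /point_ext_open E; split; last by move=> _; exact: Ffree.
    by apply: closed_openC; exact: accessible_closed_set1.
  + by rewrite inE.
  + by rewrite inE => /(_ erefl).
Qed.

(** Complete regularity is expressed by uniformities; a model of the reals is
chosen to prove it by means of functions. *)
Let R : realType := Rdefinitions.R.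

Lemma point_ext_separated (a : Y) (B : set Y) (f : Y -> R) :
  continuous f -> range f `<=` `[0%R, 1%R]%classic -> f a = 0%R ->
  (forall y, B y -> f y = 1%R) -> uniform_separator [set a] B.
Proof.
move=> cf f01 fa fB; apply/(@uniform_separatorP _ R); exists f; split => //.
  by move=> _ [_ -> <-].
by move=> _ [y /fB fy <-].
Qed.

Lemma point_ext_continuous (f : Y -> R) (W : set X) :
  continuous (f \o some) -> filter F W -> (forall x, W x -> f (some x) = f None) ->
  continuous f.
Proof.
move=> cf FW fW; apply/continuousP => O oO; rewrite point_ext_openE; split.
  by move/continuousP : cf; exact.
by move=> ON; apply: filterS FW => x /fW /= fx; rewrite /preimage /= fx.
Qed.

(** At a point of [X], a separating function on [X] is made constant on a clopen
member of [F], which allows extending it to the new point; at the new point, the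
indicator function of the complement of a clopen member of [F] separates. *)
Lemma point_ext_completely_regular : completely_regular_space Y.
Proof.
move=> [a|] B cB nBa.
- have oU : open (~` B) by exact: closed_openC.
  have [W [[oW cW] FW Wa]] := Fclopen (Ffree a).
  pose C := some @^-1` B `|` W.
  have cC : closed C.
    apply: closedU => //; rewrite -[X in closed X]setCK; apply: open_closedC.
    by have [] := oU.
  have nCa : ~ C a by case=> [/nBa|/Wa]; [|apply].
  have /(@uniform_separatorP _ R)[f [cf f01 fa fC]] :=
    locally_compact_completely_regular (R := R) Xlc Xhaus cC nCa.
  have fC1 x : C x -> f x = 1%R by move=> Cx; apply: fC; exists x.
  pose g (y : Y) : R := if y is Some x then f x else 1%R.
  apply: (@point_ext_separated _ _ g).
  + by apply: (@point_ext_continuous _ W) => // x Wx; apply: fC1; right.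
  + move=> _ [[x|] _ <-]; first by apply: f01; exists x.
    by rewrite /= in_itv /= ler01 lexx.
  + by apply: fa; exists a.
  + by move=> [x|//] Bx; apply: fC1; left.
- have [W [[oW cW] FW WB]] : exists W, [/\ clopen W, filter F W & W `<=` some @^-1` (~` B)].
    by apply: Fclopen; have [_ ] := closed_openC cB; exact.
  pose g (y : Y) : R := if y is Some x then if x \in W then 0%R else 1%R else 0%R.
  apply: (@point_ext_separated _ _ g).
  + apply: (@point_ext_continuous _ W) => //; last by move=> x Wx; rewrite /g /= mem_set.
    move=> x; have [Wx|nWx] := pselect (W x); apply: cvg_near_cst.
      have : nbhs x W by apply: open_nbhs_nbhs.
      by apply: filterS => y Wy; rewrite /g /= !mem_set.
    have : nbhs x (~` W) by apply: open_nbhs_nbhs; split => //; exact: closed_openC.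
    by apply: filterS => y Wy; rewrite /g /= !memNset.
  + move=> _ [[x|] _ <-] /=; last by rewrite in_itv /= ler01 lexx.
    by case: ifP; rewrite in_itv /= ler01 lexx.
  + by [].
  + move=> [x|] Bx //=; case: ifPn => // /set_mem /WB; exact.
Qed.

Lemma point_ext_tychonoff : tychonoff_space Y.
Proof.
by split; [exact: point_ext_accessible|exact: point_ext_completely_regular].
Qed.

End point_extension.

Definition point_extension (X : topologicalType) (F : filter_on X)
    (tyF : tychonoff_space (point_ext F)) (F0 : ~ filter F set0) :
  one_point_extension X :=
  OnePointExtension tyF (point_ext_embedding F) (point_ext_dense F0)
    (point_ext_remainder F).

Lemma ext_equiv_refl (X : topologicalType) (Y : one_point_extension X) :
  ext_equiv Y Y.
Proof.
by exists id => //; split; [|exists id; split => //]; move=> x; exact: cvg_id.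
Qed.

(** An equivalence fixes the points of [X], hence also the new point, so that it
matches the open neighbourhoods of the two new points. *)
Lemma ext_equiv_point_extension (X : topologicalType) (F G : filter_on X)
    tyF F0 tyG G0 (U : set X) :
  ext_equiv (@point_extension X F tyF F0) (@point_extension X G tyG G0) ->
  open U -> filter G U -> filter F U.
Proof.
move=> [f [cf [g [_ _ gK]]] fS] oU GU.
have fN : f None = None.
  case: (g None) (gK None) => [x|//]; have /= -> := fS x.
  by [].
pose V : set (point_ext G) := some @` U `|` [set None].
have VE : Some @^-1` V = U.
  by apply/seteqP; split=> [x [[y Uy [<-]]|]//|x Ux]; left; exists x.
have oV : open V.
  by rewrite point_ext_openE /point_ext_open VE; split.
have /continuousP/(_ V oV) [_] := cf.
rewrite /preimage /= fN => /(_ (or_intror erefl)); apply: filterS => x.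
by rewrite -[X in _ -> X x]VE; have /= -> := fS x.
Qed.

(** * Extensions given by sets of pieces *)

Section partition_extensions.
Variables (X : topologicalType) (I : Type) (q : X -> I).
Hypothesis Xlc : locally_compact [set: X].
Hypothesis Xhaus : hausdorff_space X.
Hypothesis q_surj : forall i, exists x, q x = i.
Hypothesis q_open : forall S, open (q @^-1` S).
Implicit Types (A : set X) (T : set I).

(** Discarding countable sets of pieces is what keeps the new point away from the
closed Lindelof sets. *)
Definition tail_sets T : set_system X :=
  [set U | exists2 C, countable C & q @^-1` (T `\` C) `<=` U].

Lemma tail_sets_filter T : Filter (tail_sets T).
Proof.
split.
- by exists set0; first exact: countable0.
- move=> U V [C cC CU] [D cD DV]; exists (C `|` D).
    by rewrite -bigcup2E; apply: bigcup_countable => // -[|[|n]] _ //; exact: countable0.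
  by move=> x [Tx nCD]; split; [apply: CU|apply: DV]; split => // ?; apply: nCD; [left|right].
- by move=> U V UV [C cC CU]; exists C => //; exact: subset_trans UV.
Qed.

Definition tail_filter T : filter_on X :=
  FilterType (tail_sets T) (tail_sets_filter T).

Lemma tail_filter_proper T : ~ countable T -> ~ filter (tail_filter T) set0.
Proof.
move=> uT [C cC CU]; apply: uT; apply: sub_countable (subset_card_le _) cC.
move=> i Ti; apply: contrapT => nCi; have [x xi] := q_surj i.
by apply: (CU x); split; rewrite xi.
Qed.

Lemma preimage_clopen_partition T : clopen (q @^-1` T).
Proof.
by split => //; rewrite -[X in closed X]setCK; apply: open_closedC; exact: (q_open (~` T)).
Qed.

Lemma tail_filter_tychonoff T : tychonoff_space (point_ext (tail_filter T)).
Proof.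
apply: point_ext_tychonoff => // [U [C cC CU]|x].
  exists (q @^-1` (T `\` C)); split => //; first exact: preimage_clopen_partition.
  by exists C.
exists [set q x]; first exact: countable1.
by move=> y [_ /= nxy] yx; apply: nxy; rewrite yx.
Qed.

(** The pieces form a disjoint open cover, so only countably many meet [A]. *)
Lemma lindelof_image_countable A : lindelof A -> countable (q @` A).
Proof.
move=> lA; have [|D [DC AD cD]] := lA (range (fun i => q @^-1` [set i])).
  split; first by move=> _ [i _ <-].
  by move=> x _; exists (q @^-1` [set q x]) => //; exists (q x).
apply: (@sub_countable _ _ _ (\bigcup_(V in D) (q @` V))).
  by apply: subset_card_le => _ [x /AD[V DV Vx] <-]; exists V => //; exists x.
apply: bigcup_countable => // V /DC[i _ <-].
by apply: sub_countable (subset_card_le _) (countable1 i) => _ [x ? <-].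
Qed.

Definition tail_extension T (uT : ~ countable T) : one_point_extension X :=
  point_extension (tail_filter_tychonoff T) (tail_filter_proper uT).

(** The pieces that miss [A] form, with the new point, a neighbourhood of it. *)
Lemma tail_extension_T_D T (uT : ~ countable T) :
  T_D (ext_class (tail_extension uT)).
Proof.
exists (tail_extension uT) => // A _ lA clA.
pose O : set (point_ext (tail_filter T)) := some @` (q @^-1` (~` (q @` A))) `|` [set None].
have OE : Some @^-1` O = q @^-1` (~` (q @` A)).
  by apply/seteqP; split=> [x [[y Uy [<-]]|]//|x Ux]; left; exists x.
have ON : nbhs (None : point_ext (tail_filter T)) O.
  apply: open_nbhs_nbhs; split; last by right.
  rewrite point_ext_openE /point_ext_open OE; split => // _.
  by exists (q @` A); [exact: lindelof_image_countable|move=> x []].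
have [_ [[x Ax <-] [[y Ay [yx]]|//]]] := clA O ON.
by apply: Ay; exists x; rewrite // yx.
Qed.

(** The union of the pieces in [T'] belongs to the second filter, hence to the
first. *)
Lemma tail_extension_equiv T T' (uT : ~ countable T) (uT' : ~ countable T') :
  ext_equiv (tail_extension uT) (tail_extension uT') -> countable (T `\` T').
Proof.
move=> /ext_equiv_point_extension /(_ (q_open T')) [|C cC CT'].
  by exists set0; [exact: countable0|move=> x []].
apply: sub_countable (subset_card_le _) cC => i [Ti nT'i].
apply: contrapT => nCi; have [x xi] := q_surj i.
by apply: nT'i; rewrite -xi; apply: CT'; split; rewrite xi.
Qed.

End partition_extensions.

Theorem theorem6p3 (X : topologicalType) (K : Type) :
  locally_compact [set: X] -> paracompact X -> ~ sigma_compact X ->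
  is_lindelof_number X K ->
  exists F : set K -> (one_point_extension X -> Prop),
    injective F /\ forall S : set K, T_D (F S).
Proof.
move=> Xlc Xpara nXs [infK _ Kmin]; have [Xhaus _] := Xpara.
have [I [q [q_surj q_open qcpt]]] := sigma_compact_clopen_partition Xlc Xpara.
have uI : ~ countable [set: I].
  by move=> /(sigma_compact_of_countable_partition qcpt).
have infI : infinite_set [set: I] by move=> /finite_set_countable.
have KI := Kmin I infI (cover_reduces_to_partition qcpt infI).
have [T [uT TD]] := uncountable_difference_family uI KI infK.
exists (fun S => ext_class (tail_extension Xlc Xhaus q_surj q_open (uT S))).
split=> [S S' SS'|S]; last exact: tail_extension_T_D.
apply: contrapT => /TD; apply.
apply: (@tail_extension_equiv _ _ _ Xlc Xhaus q_surj q_open _ _ (uT S) (uT S')).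
by rewrite -/(ext_class _ _) SS'; exact: ext_equiv_refl.
Qed.
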